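(* Let $A$ be a commutative Noetherian ring with unit and let $l$ be a natural number. Then $\operatorname{cmd}(A)\le l$ if and only if $A$ has the property $(C_n^l)$ for every $n\in\mathbb{N}$.
   Context: Natural numbers include $0$. For a Noetherian local ring $R$, the Cohen-Macaulay defect is $\operatorname{cmd}(R)=\dim(R)-\operatorname{depth}(R)$. For a Noetherian ring $A$ that is not local, $\operatorname{cmd}(A)=\sup\{\operatorname{cmd}(A_\mathfrak{p}) : \mathfrak{p}\in\operatorname{Spec}(A)\}$. For natural numbers $n,l$, a Noetherian ring $A$ has the property $(C_n^l)$ if $\operatorname{depth}(A_\mathfrak{p})\ge\min(\operatorname{ht}(\mathfrak{p}),n)-l$ for all $\mathfrak{p}\in\operatorname{Spec}(A)$ (an inequality of integers; the right-hand side may be negative). *)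

(* Defs.v *)
From HB Require Import structures.
From mathcomp Require Import all_boot all_order all_algebra generic_quotient.
From mathcomp Require Import boolp classical_sets constructive_ereal.
From mathcomp Require Import ring.

Set Implicit Arguments.
Unset Strict Implicit.
Unset Printing Implicit Defensive.

Import Order.TTheory GRing.Theory Num.Theory.

Local Open Scope classical_set_scope.
Local Open Scope ring_scope.
Local Open Scope quotient_scope.

(* Dimensions, heights, depths and defects take values in the extended
   integers \bar int; the supremum of the empty set is -oo. *)
Definition esup (S : set (\bar int)) : \bar int := supremum -oo%E S.

Lemma esupP (S : set (\bar int)) : supremums S (esup S).
Proof.
rewrite /esup /supremum; case: ifPn => [/eqP ->|/set0P S0].
  by split=> [x []|x _]; rewrite leNye.
suff [s sS] : supremums S !=set0 by case: xgetP => [y -> //|/(_ s)].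
have [Sy|Sy] := pselect (S +oo%E).
  by exists +oo%E; split=> [x _|x ubx]; [rewrite leey|apply: ubx].
have [[z Sz]|Snum] := pselect (exists z : int, S z%:E); last first.
  exists -oo%E; split=> [[x|//|//] Sx|x _]; rewrite ?leNye//.
  by case: Snum; exists x.
have [[b ubb]|unb] := pselect (exists b : int, ubound S b%:E); last first.
  exists +oo%E; split=> [x _|[x|//|] ubx]; rewrite ?leey//.
    by case: unb; exists x.
  by have := ubx _ Sz.
have zb : z <= b by rewrite -lee_fin; exact: ubb.
pose P n := `[< S (b - n%:Z)%:E >].
have Pz : exists n, P n.
  by exists `|b - z|%N; apply/asboolP; rewrite gez0_abs ?subr_ge0// subKr.
case: (ex_minnP Pz) => n /asboolP Sn minn.
exists (b - n%:Z)%:E; split=> [[x|//|//] Sx|x]; rewrite ?leNye//; last exact.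
rewrite lee_fin; have xb : x <= b by rewrite -lee_fin; exact: ubb.
have Px : P `|b - x|%N by apply/asboolP; rewrite gez0_abs ?subr_ge0// subKr.
have := minn _ Px; rewrite -lez_nat gez0_abs ?subr_ge0// => nbx.
by rewrite lerBrDr addrC -lerBrDr.
Qed.

Section Ideals.
Variable A : comPzRingType.
Implicit Types (I J : set A) (s : seq A).

Definition ideal I : Prop :=
  [/\ I 0, forall x y, I x -> I y -> I (x + y)
    & forall a x, I x -> I (a * x)].

Definition prime_ideal I : Prop :=
  [/\ ideal I, ~ I 1 & forall x y, I (x * y) -> I x \/ I y].

Definition maximal_ideal I : Prop :=
  [/\ ideal I, I <> setT
    & forall J, ideal J -> J <> setT -> I `<=` J -> J = I].

Definition ideal_gen s : set A :=
  [set a | exists c : 'I_(size s) -> A, a = \sum_i c i * s`_i].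

Definition noetherian : Prop :=
  forall I, ideal I -> exists s, I = ideal_gen s.

Definition is_local : Prop := exists! m : set A, maximal_ideal m.

(* Meaningful when A is local; arbitrary otherwise. *)
Definition max_ideal : set A := get maximal_ideal.

Definition Spec : Type := {P : set A | prime_ideal P}.

End Ideals.

Arguments noetherian : clear implicits.
Arguments is_local : clear implicits.
Arguments max_ideal : clear implicits.
Arguments Spec : clear implicits.

Section Dimension.
Variable A : comPzRingType.

Definition prime_chain (n : nat) (c : nat -> Spec A) : Prop :=
  forall i, (i < n)%N -> sval (c i) `<` sval (c i.+1).

Definition krull_dim : \bar int :=
  esup [set n%:Z%:E | n in [set n | exists c, prime_chain n c]].

Definition height (p : Spec A) : \bar int :=
  esup [set n%:Z%:E | n in [set n | exists2 c, prime_chain n c & c n = p]].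

End Dimension.

Arguments krull_dim : clear implicits.

Section Depth.
Variable A : comPzRingType.

(* s`_i is a nonzerodivisor on A / (s_0, ..., s_(i-1)), and A / (s) != 0. *)
Definition regular_seq (s : seq A) : Prop :=
  ideal_gen s <> setT /\
  forall i, (i < size s)%N -> forall a,
    ideal_gen (take i s) (s`_i * a) -> ideal_gen (take i s) a.

Definition depth : \bar int :=
  esup [set (size s)%:Z%:E | s in
    [set s | regular_seq s /\ forall x, x \in s -> max_ideal A x]].

(* Both terms are finite when A is local and noetherian. *)
Definition local_cmd : \bar int := (krull_dim A - depth)%E.

End Depth.

Arguments depth : clear implicits.
Arguments local_cmd : clear implicits.

Section Localization.
Variables (A : comPzRingType) (p : Spec A).

Let P : set A := sval p.

Definition loc_frac := {x : A * A | x.2 \notin P}.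

HB.instance Definition _ := Choice.on loc_frac.

Local Notation "\n_ x" := (val (x : loc_frac)).1 (at level 8, x at level 2).
Local Notation "\d_ x" := (val (x : loc_frac)).2 (at level 8, x at level 2).

Lemma loc_den1 : (1 : A) \notin P.
Proof. by apply/negP => /set_mem; case: (svalP p). Qed.

Lemma loc_denM (s t : A) : s \notin P -> t \notin P -> s * t \notin P.
Proof.
move=> /negP sP /negP tP; apply/negP => /set_mem; case: (svalP p) => _ _ h.
by move=> /h[] /mem_set.
Qed.

Definition locFrac (a s : A) (sP : s \notin P) : loc_frac := exist _ (a, s) sP.

Definition loc_equivf (x y : loc_frac) : bool :=
  `[< exists2 u, u \notin P & u * (\n_x * \d_y - \n_y * \d_x) = 0 >].

Lemma loc_equivf_refl : reflexive loc_equivf.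
Proof. by move=> x; apply/asboolP; exists 1; rewrite ?loc_den1// subrr mulr0. Qed.

Lemma loc_equivf_sym : symmetric loc_equivf.
Proof.
suff h x y : loc_equivf x y -> loc_equivf y x by move=> x y; apply/idP/idP; apply: h.
by move=> /asboolP[u uP e]; apply/asboolP; exists u => //;
  rewrite -opprB mulrN e oppr0.
Qed.

Lemma loc_equivf_trans : transitive loc_equivf.
Proof.
move=> y x z /asboolP[u uP e] /asboolP[v vP f]; apply/asboolP.
exists (u * v * \d_y); first by rewrite !loc_denM// (svalP y).
transitivity (v * \d_z * (u * (\n_x * \d_y - \n_y * \d_x)) +
              u * \d_x * (v * (\n_y * \d_z - \n_z * \d_y))); first by ring.
by rewrite e f !mulr0 addr0.
Qed.

Canonical loc_equivf_equiv := EquivRel loc_equivf loc_equivf_refl loc_equivf_sym loc_equivf_trans.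

Definition loc_type := {eq_quot loc_equivf}.

HB.instance Definition _ : EqQuotient _ loc_equivf loc_type := EqQuotient.on loc_type.
HB.instance Definition _ := Choice.on loc_type.

Lemma loc_eq_fracP (x y : loc_frac) :
  reflect (exists2 u, u \notin P & u * (\n_x * \d_y - \n_y * \d_x) = 0)
          (x == y %[mod loc_type]).
Proof. by rewrite eqmodE; exact: asboolP. Qed.

Lemma loc_eq_frac (x y : loc_frac) : \n_x * \d_y = \n_y * \d_x -> x = y %[mod loc_type].
Proof.
by move=> e; apply/eqP/loc_eq_fracP; exists 1; rewrite ?loc_den1// e subrr mulr0.
Qed.

Lemma loc_reprP (x : loc_frac) : exists2 u, u \notin P &
  u * (\n_x * \d_(repr (\pi_loc_type x)) - \n_(repr (\pi_loc_type x)) * \d_x) = 0.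
Proof. by apply/loc_eq_fracP; rewrite reprK. Qed.

Definition loc_zerof : loc_frac := locFrac 0 loc_den1.
Definition loc_onef : loc_frac := locFrac 1 loc_den1.
Definition loc_oppf (x : loc_frac) : loc_frac := locFrac (- \n_x) (valP x).
Definition loc_addf (x y : loc_frac) : loc_frac :=
  locFrac (\n_x * \d_y + \n_y * \d_x) (loc_denM (valP x) (valP y)).
Definition loc_mulf (x y : loc_frac) : loc_frac :=
  locFrac (\n_x * \n_y) (loc_denM (valP x) (valP y)).

Definition loc_zero : loc_type := \pi_loc_type loc_zerof.
Definition loc_one : loc_type := \pi_loc_type loc_onef.
Definition loc_opp := lift_op1 loc_type loc_oppf.
Definition loc_add := lift_op2 loc_type loc_addf.
Definition loc_mul := lift_op2 loc_type loc_mulf.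

Lemma loc_pi_opp (x : loc_frac) : loc_opp (\pi_loc_type x) = \pi_loc_type (loc_oppf x).
Proof.
unlock loc_opp; apply/esym/eqP/loc_eq_fracP; have [u uP e] := loc_reprP x; exists u => //=.
by rewrite -[RHS]oppr0 -e; ring.
Qed.

Lemma loc_pi_add (x y : loc_frac) : loc_add (\pi_loc_type x) (\pi_loc_type y) = \pi_loc_type (loc_addf x y).
Proof.
unlock loc_add; apply/esym/eqP/loc_eq_fracP; have [u uP e] := loc_reprP x; have [v vP f] := loc_reprP y.
exists (u * v) => /=; first exact: loc_denM.
set x' := repr _ in e *; set y' := repr _ in f *.
transitivity (v * \d_y * \d_y' * (u * (\n_x * \d_x' - \n_x' * \d_x)) +
              u * \d_x * \d_x' * (v * (\n_y * \d_y' - \n_y' * \d_y))).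
  by ring.
by rewrite e f !mulr0 addr0.
Qed.

Lemma loc_pi_mul (x y : loc_frac) : loc_mul (\pi_loc_type x) (\pi_loc_type y) = \pi_loc_type (loc_mulf x y).
Proof.
unlock loc_mul; apply/esym/eqP/loc_eq_fracP; have [u uP e] := loc_reprP x; have [v vP f] := loc_reprP y.
exists (u * v) => /=; first exact: loc_denM.
set x' := repr _ in e *; set y' := repr _ in f *.
transitivity (v * \n_y * \d_y' * (u * (\n_x * \d_x' - \n_x' * \d_x)) +
              u * \n_x' * \d_x * (v * (\n_y * \d_y' - \n_y' * \d_y))).
  by ring.
by rewrite e f !mulr0 addr0.
Qed.

Lemma loc_addA : associative loc_add.
Proof.
elim/quotW=> x; elim/quotW=> y; elim/quotW=> z.
by rewrite !loc_pi_add; apply: loc_eq_frac => /=; ring.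
Qed.

Lemma loc_addC : commutative loc_add.
Proof.
by elim/quotW=> x; elim/quotW=> y; rewrite !loc_pi_add; apply: loc_eq_frac => /=; ring.
Qed.

Lemma loc_add0 : left_id loc_zero loc_add.
Proof. by elim/quotW=> x; rewrite loc_pi_add; apply: loc_eq_frac => /=; ring. Qed.

Lemma loc_addN : left_inverse loc_zero loc_opp loc_add.
Proof.
by elim/quotW=> x; rewrite loc_pi_opp loc_pi_add; apply: loc_eq_frac => /=; ring.
Qed.

HB.instance Definition _ := GRing.isZmodule.Build loc_type loc_addA loc_addC loc_add0 loc_addN.

Lemma loc_mulA : associative loc_mul.
Proof.
elim/quotW=> x; elim/quotW=> y; elim/quotW=> z.
by rewrite !loc_pi_mul; apply: loc_eq_frac => /=; ring.
Qed.

Lemma loc_mulC : commutative loc_mul.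
Proof.
by elim/quotW=> x; elim/quotW=> y; rewrite !loc_pi_mul; apply: loc_eq_frac => /=; ring.
Qed.

Lemma loc_mul1 : left_id loc_one loc_mul.
Proof. by elim/quotW=> x; rewrite loc_pi_mul; apply: loc_eq_frac => /=; ring. Qed.

Lemma loc_mulDl : left_distributive loc_mul loc_add.
Proof.
elim/quotW=> x; elim/quotW=> y; elim/quotW=> z.
by rewrite !(loc_pi_add, loc_pi_mul); apply: loc_eq_frac => /=; ring.
Qed.

Lemma loc_one_neq0 : loc_one != 0 :> loc_type.
Proof.
apply/loc_eq_fracP => -[u /negP uP] /=.
by rewrite !mulr1 subr0 mulr1 => u0; apply: uP; rewrite u0 inE;
  case: (svalP p) => -[].
Qed.

HB.instance Definition _ :=
  GRing.Zmodule_isComNzRing.Build loc_type loc_mulA loc_mulC loc_mul1 loc_mulDl loc_one_neq0.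

End Localization.

Definition localization (A : comPzRingType) (p : Spec A) : comNzRingType :=
  loc_type p.

Definition cmd (A : comPzRingType) : \bar int :=
  if `[< is_local A >] then local_cmd A
  else esup [set local_cmd (localization p) | p in [set: Spec A]].

Definition property_C (n l : nat) (A : comPzRingType) : Prop :=
  forall p : Spec A,
    (Order.min (height p) n%:Z%:E - l%:Z%:E <= depth (localization p))%E.

(* Main.v *)
(* For a prime [p], [height p = dim A_p], so outside the local case the two
   conditions both say that every chain of primes ending at [p] is at most [l]
   longer than some regular sequence of [A_p]; no finiteness is involved. In
   the local case one needs that the defect does not increase by localization,
   which follows from [depth A <= grade(p, A) + dim (A/p)]: extend a regular
   sequence in [p] until [p] lies in an associated prime [q] of the quotient
   [B = A/(x_1, ..., x_g)]. By Rees's exchange argument [depth B] is then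
   [depth A - g], and every [B]-regular sequence of length [n] yields a chain
   of [n] strict inclusions of primes starting at [q], since cutting by a
   nonzerodivisor [x] lets one replace [q] by an associated prime of [B/xB]
   containing [q + (x)]. Noetherianity also bounds the length of regular
   sequences, so that the defect of a local ring is not an artefact of
   [+oo - oo = -oo]. *)
Require Import Defs.
From HB Require Import structures.
From mathcomp Require Import all_boot all_order all_algebra generic_quotient.
From mathcomp Require Import boolp classical_sets constructive_ereal ring zify.

Set Implicit Arguments.
Unset Strict Implicit.
Unset Printing Implicit Defensive.

Import Order.TTheory GRing.Theory Num.Theory.

Local Open Scope classical_set_scope.
Local Open Scope ring_scope.
Local Open Scope quotient_scope.

(** * Ideals, prime avoidance and associated primes *)

Section IdealTheory.
Variable A : comPzRingType.
Implicit Types (I J M P Q : set A) (s : seq A) (a b u w x y z : A).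

(** The ideal [J + (x)]. Quotient rings are never formed: [A/J] is handled through the ideal [J] of
    [A], and cutting by [x] means passing to [adjoin J x]. *)
Definition adjoin J x : set A := [set a | exists c, J (a - c * x)].

Definition colon J z : set A := [set a | J (a * z)].

Definition nonzerodivisor J x : Prop := forall a, J (x * a) -> J a.

Definition associated_prime J P : Prop :=
  prime_ideal P /\ exists2 z, ~ J z & P = colon J z.

Lemma ideal0 I : ideal I -> I 0. Proof. by case. Qed.

Lemma idealD I x y : ideal I -> I x -> I y -> I (x + y).
Proof. by case=> _ h _; apply: h. Qed.

Lemma ideal_mull I a x : ideal I -> I x -> I (a * x).
Proof. by case=> _ _ h; apply: h. Qed.

Lemma ideal_mulr I a x : ideal I -> I x -> I (x * a).
Proof. by rewrite mulrC; apply: ideal_mull. Qed.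

Lemma idealB I x y : ideal I -> I x -> I y -> I (x - y).
Proof.
by move=> idI Ix Iy; apply: idealD => //; rewrite -mulN1r; apply: ideal_mull.
Qed.

Lemma ideal_eq1 I : ideal I -> I 1 -> I = setT.
Proof.
by move=> idI I1; apply/seteqP; split=> // x _; rewrite -[x]mulr1; apply: ideal_mull.
Qed.

Lemma ideal_neq1 I : ideal I -> I <> setT -> ~ I 1.
Proof. by move=> idI IT /(ideal_eq1 idI). Qed.

Lemma ideal_set0 : ideal [set (0 : A)].
Proof.
by split=> //= [x y -> ->|a x ->]; rewrite ?addr0 ?mulr0.
Qed.

Lemma ideal_ideal_gen s : ideal (ideal_gen s).
Proof.
split=> [|x y [c ->] [d ->]|a x [c ->]].
- by exists (fun=> 0); rewrite big1// => i _; rewrite mul0r.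
- exists (fun i => c i + d i); rewrite -big_split /=.
  by apply: eq_bigr => i _; rewrite mulrDl.
- exists (fun i => a * c i); rewrite big_distrr /=.
  by apply: eq_bigr => i _; rewrite mulrA.
Qed.

Lemma ideal_gen_sub I s :
  ideal I -> (forall x, x \in s -> I x) -> ideal_gen s `<=` I.
Proof.
move=> idI sI _ [c ->]; elim/big_ind: _ => [|x y|i _].
- exact: ideal0.
- exact: idealD.
- by apply: ideal_mull => //; apply/sI/mem_nth.
Qed.

Lemma mem_ideal_gen s x : x \in s -> ideal_gen s x.
Proof.
move=> xs; have si : (index x s < size s)%N by rewrite index_mem.
exists (fun i => (i == Ordinal si)%:R).
rewrite (bigD1 (Ordinal si)) //= eqxx mul1r nth_index// big1 ?addr0// => i.
by move=> /negPf ->; rewrite mul0r.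
Qed.

Lemma ideal_gen_nil : ideal_gen [::] = [set (0 : A)].
Proof.
apply/seteqP; split=> [|_ ->]; last exact: ideal0 (ideal_ideal_gen _).
by apply: ideal_gen_sub => //; exact: ideal_set0.
Qed.

Lemma adjoin_ideal J x : ideal J -> ideal (adjoin J x).
Proof.
move=> idJ; split=> [|a b [c Jc] [d Jd]|e a [c Jc]].
- by exists 0; rewrite mul0r subr0; apply: ideal0.
- exists (c + d); have -> : a + b - (c + d) * x = a - c * x + (b - d * x) by ring.
  exact: idealD.
- exists (e * c); have -> : e * a - e * c * x = e * (a - c * x) by ring.
  exact: ideal_mull.
Qed.

Lemma sub_adjoin J x : J `<=` adjoin J x.
Proof. by move=> a Ja; exists 0; rewrite mul0r subr0. Qed.

Lemma mem_adjoin J x : ideal J -> adjoin J x x.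
Proof. by move=> idJ; exists 1; rewrite mul1r subrr; apply: ideal0. Qed.

Lemma adjoin_sub I J x : ideal I -> J `<=` I -> I x -> adjoin J x `<=` I.
Proof.
move=> idI JI Ix a [c Jc]; rewrite -(subrK (c * x) a); apply: idealD => //.
  exact: JI.
exact: ideal_mull.
Qed.

Lemma adjoinC J x y : adjoin (adjoin J x) y = adjoin (adjoin J y) x.
Proof.
by apply/seteqP; split=> a [c [d Jcd]]; exists d, c;
  rewrite addrAC.
Qed.

Lemma ideal_gen_rcons s x : ideal_gen (rcons s x) = adjoin (ideal_gen s) x.
Proof.
apply/seteqP; split.
  apply: ideal_gen_sub; first exact/adjoin_ideal/ideal_ideal_gen.
  move=> y; rewrite mem_rcons inE => /predU1P[->|ys].
    exact/mem_adjoin/ideal_ideal_gen.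
  exact/sub_adjoin/mem_ideal_gen.
apply: adjoin_sub; first exact: ideal_ideal_gen.
  apply: ideal_gen_sub; first exact: ideal_ideal_gen.
  by move=> y ys; apply: mem_ideal_gen; rewrite mem_rcons inE ys orbT.
by apply: mem_ideal_gen; rewrite mem_rcons mem_head.
Qed.

Lemma colon_ideal J z : ideal J -> ideal (colon J z).
Proof.
move=> idJ; rewrite /colon; split=> /= [|x y Jx Jy|a x Jx].
- by rewrite mul0r; apply: ideal0.
- by rewrite mulrDl; apply: idealD.
- by rewrite -mulrA; apply: ideal_mull.
Qed.

Lemma maximal_prime M : maximal_ideal M -> prime_ideal M.
Proof.
move=> [idM MT maxM]; split=> // [|x y Mxy]; first exact: ideal_neq1.
have [Mx|Mx] := pselect (M x); [by left|right].
have [c Mc] : adjoin M x 1.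
  apply: contrapT => N1; apply: Mx.
  rewrite -(maxM _ (adjoin_ideal x idM) _ (@sub_adjoin _ _)); last first.
    by move=> e; apply: N1; rewrite e.
  exact: mem_adjoin.
have -> : y = y * (1 - c * x) + c * (x * y) by ring.
by apply: idealD => //; apply: ideal_mull.
Qed.

(** Otherwise repeated choice gives a strictly increasing chain in [F]. Its union is a finitely
    generated ideal whose generators already lie in one member, where the chain would have to
    stop. *)
Lemma noetherian_max (F : set (set A)) : noetherian A ->
  (forall I, F I -> ideal I) -> F !=set0 ->
  exists2 I, F I & forall I', F I' -> I `<=` I' -> I' = I.
Proof.
move=> noeA idF [I0 FI0]; apply: contrapT => nomax.
have next I : exists I', F I -> [/\ F I', I `<=` I' & I' <> I].
  have [FI|] := pselect (F I); last by exists I.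
  apply: contrapT => h; apply: nomax; exists I => // I' FI' II'.
  by apply: contrapT => neq; apply: h; exists I'.
have {next}[f fP] := choice next; pose c n := iter n f I0.
have Fc n : F (c n) by elim: n => // n /fP[].
have cS m n : (m <= n)%N -> c m `<=` c n.
  move=> /subnK <-; elim: (n - m)%N => // k IH.
  by apply: (subset_trans IH); case: (fP _ (Fc (k + m)%N)).
pose U : set A := [set a | exists n, c n a].
have idU : ideal U.
  split=> [|x y [m cx] [n cy]|a x [n cx]].
  - by exists 0%N; apply: ideal0; apply: idF.
  - exists (maxn m n); apply: idealD; first exact: idF.
      exact: cS (leq_maxl _ _) _ cx.
    exact: cS (leq_maxr _ _) _ cy.
  - by exists n; apply: ideal_mull => //; apply: idF.
have [s Us] := noeA _ idU.
have [N cN] : exists N, forall x, x \in s -> c N x.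
  have : forall x, x \in s -> U x by move=> x xs; rewrite Us; apply: mem_ideal_gen.
  elim: s {Us} => [|x s IH] sU; first by exists 0%N.
  have [|N cN] := IH; first by move=> y ys; apply: sU; rewrite inE ys orbT.
  have [n cn] := sU x (mem_head _ _).
  exists (maxn N n) => y; rewrite inE => /predU1P[->|/cN].
    exact: cS (leq_maxr _ _) _ cn.
  exact: cS (leq_maxl _ _) _.
have [_ sub neq] := fP _ (Fc N); apply: neq; apply/seteqP; split=> // a fa.
have : U a by exists N.+1.
by rewrite Us; apply: ideal_gen_sub => //; apply: idF.
Qed.

Lemma maximal_above I : noetherian A -> ideal I -> I <> setT ->
  exists2 M, maximal_ideal M & I `<=` M.
Proof.
move=> noeA idI IT.
have [||M [idM MT IM] maxM] := @noetherian_max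
    [set J | [/\ ideal J, J <> setT & I `<=` J]] noeA.
- by move=> J [].
- by exists I; split=> //; exact: subset_refl.
by exists M => //; split=> // J idJ JT MJ; apply: maxM => //; split=> //;
  apply: subset_trans MJ.
Qed.

(** [y] is the product of an element of [I] outside [P] and, for each [Q] not inside [P], an element
    of [Q] outside [P]. *)
Lemma prime_avoidance_aux I P (Qs : seq (set A)) : ideal I -> prime_ideal P ->
  (forall Q, Q \in Qs -> ideal Q) -> ~ I `<=` P ->
  exists y, [/\ I y, ~ P y & forall Q, Q \in Qs -> ~ Q `<=` P -> Q y].
Proof.
move=> idI [idP P1 primeP] idQs IP; elim: Qs idQs => [|Q Qs IH] idQs.
  have [y] : exists y, ~ (I y -> P y) by apply/existsNP.
  by move=> /not_implyP[Iy Py]; exists y.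
have [|y [Iy Py Qsy]] := IH; first by move=> R RQs; apply: idQs; rewrite inE RQs orbT.
have [QP|QP] := pselect (Q `<=` P).
  by exists y; split=> // R; rewrite inE => /predU1P[->|/Qsy].
have [x /not_implyP[Qx Px]] : exists x, ~ (Q x -> P x) by apply/existsNP.
exists (x * y); split=> [||R].
- exact: ideal_mull.
- by move=> /primeP[].
rewrite inE => /predU1P[-> _|RQs RP].
  by apply: ideal_mulr => //; apply: idQs; rewrite mem_head.
by apply: ideal_mull; [apply: idQs; rewrite inE RQs orbT|apply: Qsy].
Qed.

(** If the element [x] found for [Ps] lies in [P], add some [y] in [I] outside [P] that lies in
    every member of [Ps] not contained in [P]. Members contained in [P] are avoided because [x + y]
    is outside [P]. *)
Lemma prime_avoidance I (Ps : seq (set A)) : ideal I ->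
  (forall P, P \in Ps -> prime_ideal P) -> (forall P, P \in Ps -> ~ I `<=` P) ->
  exists2 x, I x & forall P, P \in Ps -> ~ P x.
Proof.
move=> idI; elim: Ps => [|P Ps IH] primePs IPs.
  by exists 0 => //; apply: ideal0.
have [||x Ix Psx] := IH.
- by move=> Q QPs; apply: primePs; rewrite inE QPs orbT.
- by move=> Q QPs; apply: IPs; rewrite inE QPs orbT.
have [Px|Px] := pselect (P x); last first.
  by exists x => // Q; rewrite inE => /predU1P[->|/Psx].
have primeP := primePs P (mem_head _ _).
have idPs Q : Q \in P :: Ps -> ideal Q by move=> /primePs[].
have [|y [Iy Py Psy]] :=
    prime_avoidance_aux idI primeP _ (IPs P (mem_head _ _)) (Qs := Ps).
  by move=> Q QPs; apply: idPs; rewrite inE QPs orbT.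
have Pxy : ~ P (x + y).
  by move=> /idealB-/(_ x (idPs P (mem_head _ _)) Px); rewrite addrC addKr.
exists (x + y) => [|Q]; first exact: idealD.
rewrite inE => /predU1P[->//|QPs] Qxy.
have [/(_ _ Qxy)//|/(Psy _ QPs) Qy] := pselect (Q `<=` P).
apply: (Psx _ QPs); have -> : x = x + y - y by ring.
by apply: idealB => //; apply: idPs; rewrite inE QPs orbT.
Qed.

(* The maximal elements among the proper colon ideals (J : z) are prime, and
   finitely many of the z generate all the others; since a prime containing
   the intersection of finitely many ideals contains one of them, there are
   finitely many such maximal elements. *)
Lemma zerodivisor_cover J : noetherian A -> ideal J ->
  exists2 Ps : seq (set A), (forall P, P \in Ps -> associated_prime J P) &
    forall x, ~ nonzerodivisor J x -> exists2 P, P \in Ps & P x.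
Proof.
move=> noeA idJ.
pose maxcolon z := ~ J z /\
  forall w, ~ J w -> colon J z `<=` colon J w -> colon J w = colon J z.
have maxcolonP z : ~ J z -> exists2 w, maxcolon w & colon J z `<=` colon J w.
  move=> Jz; have [||_ [w Jw [zw <-]] maxw] := @noetherian_max
      [set I | exists2 w, ~ J w & colon J z `<=` colon J w /\ colon J w = I] noeA.
  - by move=> _ [w _ [_ <-]]; apply: colon_ideal.
  - by exists (colon J z), z => //; split=> //; exact: subset_refl.
  - exists w => //; split=> // v Jv wv.
    by apply: maxw => //; exists v => //; split=> //; exact: subset_trans wv.
have prime_maxcolon z : maxcolon z -> prime_ideal (colon J z).
  move=> [Jz maxz]; split; first exact: colon_ideal.
    by rewrite /colon /= mul1r.
  move=> x y; rewrite /colon /= => Jxyz.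
  have [Jyz|Jyz] := pselect (J (y * z)); [by right|left].
  have zyz : colon J z `<=` colon J (y * z).
    by move=> a; rewrite /colon /= mulrCA; apply: ideal_mull.
  have : colon J (y * z) x by rewrite /colon /= mulrA.
  by rewrite (maxz _ Jyz).
have [||_ [zs zsmax <-] maxzs] := @noetherian_max
    [set I | exists2 zs, {in zs, forall z, maxcolon z} & ideal_gen zs = I] noeA.
- by move=> _ [zs _ <-]; apply: ideal_ideal_gen.
- by exists (ideal_gen [::]), [::].
exists [seq colon J z | z <- zs] => [_ /mapP[z zzs ->]|x].
  by split; [apply/prime_maxcolon/zsmax|exists z => //; case: (zsmax z zzs)].
move=> /existsNP[z /not_implyP[Jxz Jz]].
have [w maxw zw] := maxcolonP z Jz.
have zsw : ideal_gen zs w.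
  rewrite -(maxzs (ideal_gen (w :: zs))); first by apply: mem_ideal_gen; rewrite mem_head.
    by exists (w :: zs) => // v; rewrite inE => /predU1P[->|/zsmax].
  apply: ideal_gen_sub; first exact: ideal_ideal_gen.
  by move=> v vzs; apply: mem_ideal_gen; rewrite inE vzs orbT.
have wx : colon J w x by apply: zw.
have [z0 z0zs z0w] : exists2 z0, z0 \in zs & colon J z0 `<=` colon J w.
  (* Otherwise some [y] outside the prime [colon J w] lies in [colon J z] for all [z] in [zs]. Then
     [y] multiplies the ideal generated by [zs], and with it [w], into [J]. *)
  apply: contrapT => nosub.
  have [//|||y [_ wy Qy]] := @prime_avoidance_aux setT _
      [seq colon J z | z <- zs] _ (prime_maxcolon w maxw).
  - by move=> _ /mapP[v _ ->]; apply: colon_ideal.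
  - by move=> /(_ 1 I); case: (prime_maxcolon w maxw).
  apply: wy; rewrite /colon /= mulrC.
  have sub : ideal_gen zs `<=` colon J y.
    apply: ideal_gen_sub; first exact: colon_ideal.
    move=> v vzs; rewrite /colon /= mulrC; apply: (Qy (colon J v)).
      exact: map_f.
    by move=> vw; apply: nosub; exists v.
  exact: sub zsw.
exists (colon J z0); first exact: map_f.
have [_ maxz0] := zsmax _ z0zs.
by rewrite -(maxz0 w)//; case: maxw.
Qed.
End IdealTheory.

(** * Regular sequences and the chains of primes they produce *)

Section RegularSequences.
Variable A : comPzRingType.
Implicit Types (I J P Q : set A) (s : seq A) (a b u w x y z : A).

(* [I] contains an (A/J)-regular sequence of length [n], without the
   condition that the quotient by the sequence be nonzero. *)
Fixpoint has_regular I n J : Prop :=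
  if n is n'.+1 then
    exists x, [/\ I x, nonzerodivisor J x & has_regular I n' (adjoin J x)]
  else True.

Fixpoint chain_from n P : Prop :=
  prime_ideal P /\
  if n is n'.+1 then exists2 Q, P `<` Q & chain_from n' Q else True.

Lemma has_regular_leq I m n J : (n <= m)%N ->
  has_regular I m J -> has_regular I n J.
Proof.
elim: n m J => [//|n IH] [//|m] J nm [x [Ix nzx regx]].
by exists x; split=> //; apply: IH regx.
Qed.

(** The prefix [s] serves the induction: the first element of the sequence moves into it. *)
Lemma has_regularP I n s :
  has_regular I n (ideal_gen s) <->
  exists t, [/\ size t = n, forall x, x \in t -> I x & forall i, (i < size t)%N ->
    nonzerodivisor (ideal_gen (s ++ take i t)) t`_i].
Proof.
elim: n s => [|n IH] s; first by split=> // _; exists [::].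
split=> [[x [Ix nzx]]|[[|x t] [//= [st] It nzt]]].
  rewrite -ideal_gen_rcons => /IH[t [st It nzt]].
  exists (x :: t); split=> [|y|[|i]] /=; first by rewrite st.
  - by rewrite inE => /predU1P[->|/It].
  - by rewrite cats0.
  - by rewrite ltnS => /nzt; rewrite cat_rcons.
exists x; split; first by apply: It; rewrite mem_head.
  by have := nzt 0%N isT; rewrite /= cats0.
rewrite -ideal_gen_rcons; apply/IH; exists t; split=> // [y yt|i it].
  by apply: It; rewrite inE yt orbT.
by have := nzt i.+1 it; rewrite /= cat_rcons.
Qed.

(** The properness clause of [regular_seq] comes from the sequence lying in the proper ideal [I]. *)
Lemma regular_seqE I n : ideal I -> ~ I 1 ->
  (exists t : seq A, [/\ size t = n, regular_seq t & forall x, x \in t -> I x]) <->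
  has_regular I n [set 0].
Proof.
move=> idI I1; rewrite -ideal_gen_nil; split=> [[t [st [_ nzt] It]]|].
  by apply/has_regularP; exists t.
move=> /has_regularP[t [st It nzt]]; exists t; split=> //; split=> // tT.
by apply: I1; apply: (ideal_gen_sub idI It); rewrite tT.
Qed.

Lemma associated_prime_nzd J P x :
  associated_prime J P -> nonzerodivisor J x -> ~ P x.
Proof. by move=> [_ [z Jz ->]] nzx Jxz; apply/Jz/nzx. Qed.

(** [zerodivisor_cover] puts the zerodivisors modulo each of the [Js] into finitely many associated
    primes; prime avoidance escapes all of them at once. *)
Lemma exists_nonzerodivisor I (Js : seq (set A)) : noetherian A -> ideal I ->
  (forall J, J \in Js -> ideal J) ->
  (forall J, J \in Js -> forall P, associated_prime J P -> ~ I `<=` P) ->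
  exists2 x, I x & forall J, J \in Js -> nonzerodivisor J x.
Proof.
move=> noeA idI idJs IJs.
have [Ps Psass Pscov] : exists2 Ps : seq (set A),
    (forall P, P \in Ps -> exists2 J, J \in Js & associated_prime J P) &
    forall J x, J \in Js -> ~ nonzerodivisor J x -> exists2 P, P \in Ps & P x.
  elim: Js idJs {IJs} => [|J Js IH] idJs; first by exists [::].
  have [|Ps Psass Pscov] := IH.
    by move=> K KJs; apply: idJs; rewrite inE KJs orbT.
  have [Qs Qsass Qscov] := zerodivisor_cover noeA (idJs J (mem_head _ _)).
  exists (Qs ++ Ps) => [P|K x].
    rewrite mem_cat => /orP[/Qsass assP|/Psass[K KJs assP]].
      by exists J => //; rewrite mem_head.
    by exists K => //; rewrite inE KJs orbT.
  rewrite inE => /predU1P[-> /Qscov|KJs /(Pscov _ _ KJs)] [P PPs Px];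
    by exists P => //; rewrite mem_cat PPs ?orbT.
have [||x Ix Psx] := @prime_avoidance _ I Ps idI.
- by move=> P /Psass[J _ []].
- by move=> P /Psass[J JJs]; apply: IJs.
exists x => // J JJs; apply: contrapT => /(Pscov _ _ JJs)[P PPs].
exact: Psx.
Qed.

Lemma nonzerodivisor_or_associated I J : noetherian A -> ideal I -> ideal J ->
  (exists2 x, I x & nonzerodivisor J x) \/
  exists2 P, associated_prime J P & I `<=` P.
Proof.
move=> noeA idI idJ.
have [ass|noass] := pselect (exists2 P, associated_prime J P & I `<=` P).
  by right.
left; have [||x Ix nzx] := @exists_nonzerodivisor I [:: J] noeA idI.
- by move=> K; rewrite inE => /eqP ->.
- by move=> K; rewrite inE => /eqP -> P assP IP; apply: noass; exists P.
by exists x => //; apply: nzx; rewrite mem_head.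
Qed.

(** If [x * a] is [c * y] modulo [J], regularity of [y] gives [c = d * x] modulo [J]; cancelling [x]
    leaves [a = d * y] modulo [J]. *)
Lemma nonzerodivisor_swap J x y : ideal J ->
  nonzerodivisor J x -> nonzerodivisor (adjoin J x) y ->
  nonzerodivisor (adjoin J y) x.
Proof.
move=> idJ nzx nzy a [c Jc].
have [d Jd] : adjoin J x c.
  apply: nzy; exists a; have -> : y * c - a * x = 0 - (x * a - c * y) by ring.
  by apply: idealB => //; apply: ideal0.
exists d; apply: nzx.
have -> : x * (a - d * y) = x * a - c * y + y * (c - d * x) by ring.
by apply: idealD => //; apply: ideal_mull.
Qed.

(* If [I] kills [z] modulo [J + x] and [y * z = v * x] modulo [J], then
   [I] kills [v] modulo [J + y]. *)
Lemma nonzerodivisor_exchange I J x y w : noetherian A -> ideal I -> ideal J ->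
  I x -> I y -> nonzerodivisor J x -> nonzerodivisor J y ->
  I w -> nonzerodivisor (adjoin J y) w ->
  forall P, associated_prime (adjoin J x) P -> ~ I `<=` P.
Proof.
move=> noeA idI idJ Ix Iy nzx nzy Iw nzw P [_ [z Jz ->]] Iz.
have [v Jv] := Iz _ Iy; have [b Jb] := Iz _ Iw.
have [e Je] : adjoin J y v.
  apply: nzw; exists b; apply: nzx.
  have -> : x * (w * v - b * y) = y * (w * z - b * x) - w * (y * z - v * x) by ring.
  by apply: idealB => //; apply: ideal_mull.
(* As [v] is [e * y] modulo [J], cancelling [y] puts [z] into [J + (x)], against the choice of
   [z]. *)
apply: Jz; exists e; apply: nzy.
have -> : y * (z - e * x) = y * z - v * x + x * (v - e * y) by ring.
by apply: idealD => //; apply: ideal_mull.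
Qed.

(* Choosing [w] regular modulo [J], [J + x] and [J + y], where [y] starts the
   given sequence, one may pass from [y] to [w] and then from [w] to [x]. *)
Lemma has_regular_adjoin I n J x : noetherian A -> ideal I -> ideal J ->
  I x -> nonzerodivisor J x -> has_regular I n.+1 J -> has_regular I n (adjoin J x).
Proof.
move=> noeA idI; elim: n J x => [//|n IH] J x idJ Ix nzx [y [Iy nzy regy]].
(* The second element [z] shows that no associated prime of [J + (y)] contains [I]; the exchange
   lemma carries this over to [J + (x)]. *)
have [z [Iz nzz _]] := regy.
have idJx := adjoin_ideal x idJ; have idJy := adjoin_ideal y idJ.
have [||w Iw nzw] :=
    @exists_nonzerodivisor I [:: J; adjoin J x; adjoin J y] noeA idI.
- by move=> K; rewrite !inE => /or3P[] /eqP ->.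
- move=> K; rewrite !inE => /or3P[] /eqP -> P assP IP.
  + exact: associated_prime_nzd assP nzx (IP _ Ix).
  + exact: nonzerodivisor_exchange nzx nzy Iz nzz _ assP IP.
  + exact: associated_prime_nzd assP nzz (IP _ Iz).
have nzJ : nonzerodivisor J w by apply: nzw; rewrite !inE eqxx.
have nzJx : nonzerodivisor (adjoin J x) w by apply: nzw; rewrite !inE eqxx orbT.
have nzJy : nonzerodivisor (adjoin J y) w by apply: nzw; rewrite !inE eqxx !orbT.
exists w; split=> //; rewrite adjoinC; apply: (IH) => //.
- exact: adjoin_ideal.
- exact: nonzerodivisor_swap.
exists y; split=> //; first exact: nonzerodivisor_swap.
by rewrite adjoinC; apply: IH.
Qed.

(** Otherwise take [K] maximal among the ideals inside [I] that admit sequences of every length. For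
    a first element [x], [K + (x)] is again such an ideal, so [x] lies in [K], and regularity of [x]
    forces [1] into [K]. *)
Lemma has_regular_bounded I J : noetherian A -> ideal I -> ~ I 1 -> ideal J ->
  J `<=` I -> exists n, ~ has_regular I n J.
Proof.
move=> noeA idI I1 idJ JI; apply: contrapT => /forallNP allJ.
have [||K [idK KI allK] maxK] := @noetherian_max _
  [set K | [/\ ideal K, K `<=` I & forall n, has_regular I n K]] noeA.
- by move=> K [].
- by exists J; split=> // n; apply: contrapT.
have [x [Ix nzx _]] := allK 1%N.
apply/I1/KI/nzx; rewrite mulr1.
rewrite -[K in K x](maxK (adjoin K x)); first exact: mem_adjoin.
  split=> [||n]; first exact: adjoin_ideal.
    exact: adjoin_sub.
  exact: has_regular_adjoin.
exact: sub_adjoin.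
Qed.

(* Nakayama's lemma for the submodule of A/J killed by [Q], which is nonzero
   and satisfies [N = x N] as soon as it is contained in [x (A/J)]. *)
Lemma annihilated_outside_adjoin J Q x : noetherian A -> ideal J ->
  associated_prime J Q -> nonzerodivisor J x ->
  (forall a, exists u, u * (1 - a * x) = 1) ->
  exists2 w, ~ adjoin J x w & forall a, Q a -> J (a * w).
Proof.
move=> noeA idJ [_ [z Jz eQ]] nzx radx; apply: contrapT => now.
(* Take [J + (w)] maximal with [w] nonzero modulo [J] and killed by [Q]. Then [w = v * x] modulo [J]
   with [v] also killed by [Q], and maximality gives [v = a * w = a * x * v] modulo [J], where
   [1 - a * x] is a unit. *)
have [||_ [w Jw [Qw <-]] maxw] := @noetherian_max _
  [set K | exists2 w, ~ J w & (forall a, Q a -> J (a * w)) /\ adjoin J w = K] noeA.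
- by move=> _ [w _ [_ <-]]; apply: adjoin_ideal.
- by exists (adjoin J z), z => //; split=> // a; rewrite eQ.
have [v Jv] : adjoin J x w by apply: contrapT => nxw; apply: now; exists w.
have Qv a : Q a -> J (a * v).
  move=> /Qw Jaw; apply: nzx.
  have -> : x * (a * v) = a * w - a * (w - v * x) by ring.
  by apply: idealB => //; apply: ideal_mull.
have Jv0 : ~ J v.
  move=> Jv0; apply: Jw; have -> : w = w - v * x + x * v by ring.
  by apply: idealD => //; apply: ideal_mull.
have [a Ja] : adjoin J w v.
  rewrite -(maxw (adjoin J v)); first exact: mem_adjoin.
    by exists v.
  apply: adjoin_sub; [exact: adjoin_ideal|exact: sub_adjoin|].
  by exists x; rewrite mulrC.
have [u ux] := radx a; apply: Jv0.
have -> : v = u * (v - a * w + a * (w - v * x)).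
  by rewrite -[LHS]mul1r -ux; ring.
by apply: ideal_mull => //; apply: idealD => //; apply: ideal_mull.
Qed.

(** Some [w] nonzero modulo [J + (x)] is killed by [Q + (x)], which therefore lies in an associated
    prime [P] of [J + (x)]. The inclusion of [Q] in [P] is strict since the nonzerodivisor [x] is
    not in [Q]. *)
Lemma chain_from_associated m n J Q : noetherian A -> ideal J ->
  (forall x, m x -> exists u, u * (1 - x) = 1) -> ideal m ->
  associated_prime J Q -> has_regular m n J -> chain_from n Q.
Proof.
move=> noeA + radm idm; elim: n J Q => [|n IH] J Q idJ assQ; first by case: assQ.
move=> [x [mx nzx regx]].
have [primeQ _] := assQ; have [idQ _ _] := primeQ.
have [w Jxw Qw] : exists2 w, ~ adjoin J x w & forall a, Q a -> J (a * w).
  apply: annihilated_outside_adjoin nzx _ => // a; apply: radm; exact: ideal_mull.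
have [[b [c Qc] nzb]|[P assP QxP]] := nonzerodivisor_or_associated noeA
    (adjoin_ideal x idQ) (adjoin_ideal x idJ).
  case: Jxw; apply: nzb; exists (c * w).
  have -> : b * w - c * w * x = (b - c * x) * w by ring.
  exact: Qw.
split=> //; exists P; last exact: IH (adjoin_ideal x idJ) assP regx.
split; first by apply: subset_trans QxP; exact: sub_adjoin.
move=> PQ; apply: (associated_prime_nzd assQ nzx).
by apply/PQ/QxP; exact: mem_adjoin.
Qed.

(* The inequality [depth A <= grade(P, A) + dim (A/P)]. *)
Lemma regular_split m n J P : noetherian A -> ideal J ->
  (forall x, m x -> exists u, u * (1 - x) = 1) -> ideal m ->
  prime_ideal P -> P `<=` m -> has_regular m n J ->
  exists g, [/\ (g <= n)%N, has_regular P g J & chain_from (n - g) P].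
Proof.
move=> noeA + radm idm primeP Pm; have [idP _ _] := primeP.
elim: n J => [|n IH] J idJ regJ; first by exists 0%N; split.
have [[x Px nzx]|[Q assQ PQ]] := nonzerodivisor_or_associated noeA idP idJ.
  have [|g [gn regg chg]] := IH _ (adjoin_ideal x idJ).
    by apply: has_regular_adjoin => //; apply: Pm.
  by exists g.+1; split=> //; exists x.
exists 0%N; split=> //; rewrite subn0.
(* The lowest prime [Q] of the chain is replaced by the smaller [P], which keeps the length. *)
have [_ [R [QR RQ] chR]] := chain_from_associated noeA idJ radm idm assQ regJ.
split=> //; exists R => //; split; first exact: subset_trans QR.
by move=> RP; apply: RQ; exact: subset_trans PQ.
Qed.

End RegularSequences.

(** * Changing and extending chains of primes *)

Section PrimeChains.
Variable A : comPzRingType.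
Implicit Types (c : nat -> Spec A) (p : Spec A).

Lemma prime_chain_le n c i j : prime_chain n c -> (i <= j <= n)%N ->
  sval (c i) `<=` sval (c j).
Proof.
move=> cP /andP[/subnK <-]; elim: (j - i)%N => [_|k IH kn].
  exact: subset_refl.
apply: (subset_trans (IH (ltnW kn))).
by have [] := cP _ kn.
Qed.

Lemma prime_chain_top n c p : prime_chain n c -> sval (c n) `<=` sval p ->
  exists2 d, prime_chain n d & d n = p.
Proof.
move=> cP cnp; exists (fun i => if (i < n)%N then c i else p); last by rewrite ltnn.
move=> i ltin; have [cS Sc] := cP i ltin; rewrite ltin; case: ltnP => // nSi.
have en : n = i.+1 by apply/eqP; rewrite eqn_leq nSi.
rewrite en in cnp; split; first exact: subset_trans cnp.
by move=> pc; apply: Sc; apply: subset_trans pc.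
Qed.

Lemma prime_chain_extend h n c p : prime_chain h c -> c h = p ->
  chain_from n (sval p) -> exists d : nat -> Spec A, prime_chain (h + n) d.
Proof.
elim: n h c p => [|n IH] h c p cP ch; first by rewrite addn0; exists c.
move=> [_ [Q pQ chQ]]; have primeQ : prime_ideal Q by case: n chQ {IH} => [|n] [].
rewrite addnS -addSn.
pose q : Spec A := exist _ Q primeQ.
apply: (IH _ (fun i => if (i <= h)%N then c i else q) q) => //.
  move=> i; rewrite ltnS leq_eqVlt => /predU1P[->|ltih].
    by rewrite eqxx ltnn ch.
  by rewrite ltih orbT; apply: cP.
by rewrite ltnn.
Qed.

End PrimeChains.

(** * Ideals, prime chains and regular sequences under localization *)

Section Localization.
Variables (A : comPzRingType) (p : Spec A).
Implicit Types (J Q : set A) (a b s : A) (y : localization p).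

Let P : set A := sval p.
Let primeP : prime_ideal P := svalP p.

Definition to_loc (a : A) : localization p :=
  \pi_(loc_type p) (locFrac a (loc_den1 p)).

Fact to_loc_is_zmod_morphism : zmod_morphism to_loc.
Proof.
move=> a b; rewrite -[RHS]/(loc_add _ (loc_opp _)) loc_pi_opp loc_pi_add.
by apply: loc_eq_frac => /=; ring.
Qed.

Fact to_loc_is_monoid_morphism : monoid_morphism to_loc.
Proof.
split=> // a b; rewrite -[RHS]/(loc_mul _ _) loc_pi_mul.
by apply: loc_eq_frac => /=; ring.
Qed.

HB.instance Definition _ :=
  GRing.isZmodMorphism.Build A (localization p) to_loc to_loc_is_zmod_morphism.
HB.instance Definition _ :=
  GRing.isMonoidMorphism.Build A (localization p) to_loc to_loc_is_monoid_morphism.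

Lemma to_loc_unit s : ~ P s -> exists y, y * to_loc s = 1.
Proof.
move=> sp; have sP : s \notin sval p by apply/negP => /set_mem.
exists (\pi_(loc_type p) (locFrac 1 sP)).
by rewrite -[LHS]/(loc_mul _ _) loc_pi_mul; apply: loc_eq_frac => /=; ring.
Qed.

(** From here on a fraction [y = a / s] is used only through the equation [y * to_loc s = to_loc a],
    without quotient representatives. *)
Lemma to_loc_frac y : exists a s, ~ P s /\ y * to_loc s = to_loc a.
Proof.
elim/quotW: y => -[[a s] /= sP]; exists a, s; split.
  by move=> /mem_set; apply/negP.
by rewrite -[LHS]/(loc_mul _ _) loc_pi_mul; apply: loc_eq_frac => /=; ring.
Qed.

Lemma to_loc_eq0 a : to_loc a = 0 -> exists2 u, ~ P u & u * a = 0.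
Proof.
move=> /eqP /loc_eq_fracP[u uP] /= ua; exists u.
  by move=> /mem_set; apply/negP.
by rewrite -[RHS]ua; ring.
Qed.

Lemma to_loc_eq a b : to_loc a = to_loc b -> exists2 u, ~ P u & u * a = u * b.
Proof.
move=> /eqP; rewrite -subr_eq0 -rmorphB => /eqP /to_loc_eq0[u uP /eqP].
by rewrite mulrBr subr_eq0 => /eqP; exists u.
Qed.

Lemma prime_mulN Q s t : prime_ideal Q -> ~ Q s -> ~ Q t -> ~ Q (s * t).
Proof. by move=> [_ _ primeQ] Qs Qt /primeQ[]. Qed.

Definition extension J : set (localization p) :=
  [set y | exists a s, [/\ ~ P s, J a & y * to_loc s = to_loc a]].

Definition contraction (K : set (localization p)) : set A := to_loc @^-1` K.

Lemma extension_to_loc J a : J a -> extension J (to_loc a).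
Proof. by case: primeP => _ P1 _ Ja; exists a, 1; rewrite rmorph1 mulr1. Qed.

Lemma extension_ideal J : ideal J -> ideal (extension J).
Proof.
move=> idJ; split=> [|y z [a [s [sP Ja ya]]] [b [t [tP Jb zb]]]|z y [a [s [sP Ja ya]]]].
- by rewrite -(rmorph0 to_loc); apply: extension_to_loc; apply: ideal0.
- exists (a * t + b * s), (s * t); split; first exact: prime_mulN.
    by apply: idealD => //; apply: ideal_mulr.
  rewrite rmorphD !rmorphM /= -ya -zb; ring.
- have [b [t [tP zb]]] := to_loc_frac z.
  exists (b * a), (t * s); split; [exact: prime_mulN|exact: ideal_mull|].
  by rewrite !rmorphM /= -ya -zb; ring.
Qed.

Lemma contraction_ideal (K : set (localization p)) : ideal K -> ideal (contraction K).
Proof.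
move=> idK; rewrite /contraction; split=> /= [|a b Ka Kb|a b Kb].
- by rewrite rmorph0; apply: ideal0.
- by rewrite rmorphD; apply: idealD.
- by rewrite rmorphM; apply: ideal_mull.
Qed.

Lemma ideal_fracE (K : set (localization p)) y a s : ideal K -> ~ P s ->
  y * to_loc s = to_loc a -> K y <-> K (to_loc a).
Proof.
move=> idK sP ya; split=> [Ky|Ka]; first by rewrite -ya; apply: ideal_mulr.
have [z zs] := to_loc_unit sP.
by rewrite -[y]mulr1 -zs mulrCA mulrA -mulrA ya; apply: ideal_mull.
Qed.

Lemma contraction_sub (K : set (localization p)) :
  ideal K -> ~ K 1 -> contraction K `<=` P.
Proof.
move=> idK K1 a Ka; apply: contrapT => /to_loc_unit[y ya].
by apply: K1; rewrite -ya; apply: ideal_mull.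
Qed.

Lemma contraction_prime (K : set (localization p)) :
  prime_ideal K -> prime_ideal (contraction K).
Proof.
move=> [idK K1 primeK]; split; first exact: contraction_ideal.
  by rewrite /contraction /= rmorph1.
by move=> a b; rewrite /contraction /= rmorphM => /primeK.
Qed.

Lemma contraction_le (K L : set (localization p)) : ideal K -> ideal L ->
  contraction K `<=` contraction L -> K `<=` L.
Proof.
move=> idK idL KL y; have [a [s [sP ya]]] := to_loc_frac y.
by rewrite (ideal_fracE idK sP ya) (ideal_fracE idL sP ya); apply: KL.
Qed.

(** Clearing denominators puts [u * (a * s)] into [Q] with [u] and [s] outside [P], hence outside
    [Q]. *)
Lemma extension_prime_to_loc Q a : prime_ideal Q -> Q `<=` P ->
  extension Q (to_loc a) -> Q a.
Proof.
move=> [idQ _ primeQ] QP [b [s [sP Qb]]]; rewrite -rmorphM.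
move=> /to_loc_eq[u uP e]; have : Q (u * (a * s)) by rewrite e; apply: ideal_mull.
by move=> /primeQ[/QP//|/primeQ[//|/QP]].
Qed.

Lemma contraction_extension Q : prime_ideal Q -> Q `<=` P ->
  contraction (extension Q) = Q.
Proof.
move=> primeQ QP; apply/seteqP; split=> a; first exact: extension_prime_to_loc.
exact: extension_to_loc.
Qed.

Lemma extension_prime Q : prime_ideal Q -> Q `<=` P -> prime_ideal (extension Q).
Proof.
move=> primeQ QP; have [idQ Q1 mulQ] := primeQ; have idE := extension_ideal idQ.
split=> // [|y z].
  by rewrite -(rmorph1 to_loc) => /(extension_prime_to_loc primeQ QP).
have [a [s [sP ya]]] := to_loc_frac y; have [b [t [tP zb]]] := to_loc_frac z.
rewrite (ideal_fracE idE sP ya) (ideal_fracE idE tP zb).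
have yz : y * z * to_loc (s * t) = to_loc (a * b) by rewrite !rmorphM /= -ya -zb; ring.
rewrite (ideal_fracE idE (prime_mulN primeP sP tP) yz).
move=> /(extension_prime_to_loc primeQ QP)/mulQ[] ?; [left|right];
  exact: extension_to_loc.
Qed.

Lemma extension_adjoin J x : ideal J ->
  extension (adjoin J x) = adjoin (extension J) (to_loc x).
Proof.
move=> idJ; have idE := extension_ideal idJ; apply/seteqP; split=> y.
  move=> [a [s [sP [c Jc] ya]]]; apply/(ideal_fracE _ sP ya).
    exact: adjoin_ideal.
  exists (to_loc c); rewrite -rmorphM -rmorphB; exact: extension_to_loc.
have idEx := extension_ideal (adjoin_ideal x idJ).
apply: adjoin_sub => //.
  move=> z [a [s [sP Ja za]]]; exists a, s; split=> //; exact: sub_adjoin.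
by apply: extension_to_loc; exact: mem_adjoin.
Qed.

Lemma extension_set0 : extension [set 0] = [set 0].
Proof.
apply/seteqP; split=> [y [_ [s [sP -> ys]]]|_ ->].
  apply/(ideal_fracE (@ideal_set0 _) sP ys); exact: rmorph0.
by rewrite -(rmorph0 to_loc); apply: extension_to_loc.
Qed.

(** For [y = b / t], clearing denominators in [x * b = a / s] gives [u * x * b * s = u * a] in [J],
    so [b * s * u] lies in [J], and [b] is the fraction of it by [s * u]. *)
Lemma extension_nonzerodivisor J x : ideal J -> nonzerodivisor J x ->
  nonzerodivisor (extension J) (to_loc x).
Proof.
move=> idJ nzx y; have [b [t [tP yb]]] := to_loc_frac y.
rewrite (ideal_fracE (extension_ideal idJ) tP yb).
move=> /(ideal_mulr (to_loc t) (extension_ideal idJ)).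
rewrite -mulrA yb -rmorphM => -[a [s [sP Ja]]].
rewrite -rmorphM => /to_loc_eq[u uP e].
exists (b * s * u), (s * u); split; first exact: prime_mulN.
  apply: nzx; have -> : x * (b * s * u) = u * a by rewrite -e; ring.
  exact: ideal_mull.
by rewrite -!rmorphM mulrA.
Qed.

Lemma has_regular_extension n J Q : ideal J ->
  has_regular Q n J -> has_regular (extension Q) n (extension J).
Proof.
elim: n J => [//|n IH] J idJ [x [Qx nzx regx]].
exists (to_loc x); split; first exact: extension_to_loc.
  exact: extension_nonzerodivisor.
by rewrite -extension_adjoin//; apply: IH => //; exact: adjoin_ideal.
Qed.

(** Every proper ideal contracts into [P], hence lies in the extension of [P], which is itself
    proper. *)
Lemma maximal_extension (M : set (localization p)) : maximal_ideal M <-> M = extension P.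
Proof.
have [idP P1 _] := primeP.
have [idE E1 _] := extension_prime primeP (@subset_refl _ P).
have ET : extension P <> setT by move=> eT; apply: E1; rewrite eT.
have subE (K : set (localization p)) : ideal K -> K <> setT -> K `<=` extension P.
  move=> idK KT; apply: contraction_le => //; apply: subset_trans.
    exact/(contraction_sub idK)/ideal_neq1.
  exact: extension_to_loc.
split=> [[idM MT maxM]|->].
  by apply/esym/maxM => //; apply: subE.
by split=> // K idK KT EK; apply/seteqP; split=> //; apply: subE.
Qed.

Lemma max_ideal_localization : max_ideal (localization p) = extension P.
Proof.
apply/maximal_extension; apply: (@getPex _ (@maximal_ideal _)).
by exists (extension P); apply/maximal_extension.
Qed.

Lemma localization_dim n :
  (exists c : nat -> Spec (localization p), prime_chain n c) <->
  exists2 c, prime_chain n c & c n = p.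
Proof.
split=> [[c cP]|[c cP cn]].
  pose d i : Spec A := exist _ _ (contraction_prime (svalP (c i))).
  apply: (@prime_chain_top _ n d) => [i /cP[cS Sc]|].
    have [[idc _ _] [idS _ _]] := (svalP (c i), svalP (c i.+1)).
    by split=> [a /cS//|/contraction_le] /(_ idS idc).
  by case: (svalP (c n)) => id1 c1 _; exact: contraction_sub.
(* A chain is a total function, and its values beyond [n] may leave [P]; truncating the index makes
   every extension prime. *)
have subP i : sval (c (minn i n)) `<=` P.
  by rewrite /P -cn; apply: (prime_chain_le cP); rewrite geq_minr leqnn.
exists (fun i => exist _ _ (extension_prime (svalP (c (minn i n))) (@subP i))).
move=> i ltin /=; rewrite (minn_idPl ltin) (minn_idPl (ltnW ltin)).
have [cS Sc] := cP i ltin; split=> [y [a [s [sP ca ya]]]|sub].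
  by exists a, s; split=> //; apply: cS.
apply: Sc => a ca; apply: (extension_prime_to_loc (svalP (c i))).
  by rewrite -(minn_idPl (ltnW ltin)).
by apply: sub; exact: extension_to_loc.
Qed.

Lemma localization_depth n :
  (exists t, [/\ size t = n, regular_seq t
    & forall x, x \in t -> max_ideal (localization p) x])
  <-> has_regular (extension P) n [set 0].
Proof.
rewrite max_ideal_localization.
have [idE E1 _] := extension_prime primeP (@subset_refl _ P).
exact: regular_seqE.
Qed.

(** If all elements outside [P] are units, [to_loc] is bijective. Surjectivity lifts sequences here;
    injectivity is [contraction_set0]. This brings depth back from the localization of a local ring
    at its maximal ideal. *)
Lemma has_regular_contraction n (K L : set (localization p)) :
  (forall s, ~ P s -> exists u, u * s = 1) -> ideal K ->
  has_regular K n L -> has_regular (contraction K) n (contraction L).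
Proof.
move=> unitA idK.
have surj y : exists a, y = to_loc a.
  have [a [s [/unitA[u us] ya]]] := to_loc_frac y; exists (a * u).
  by rewrite rmorphM /= -ya -mulrA -rmorphM [s * u]mulrC us rmorph1 mulr1.
elim: n L => [//|n IH] L [y [Ky nzy regy]].
have [x ex] := surj y; rewrite {}ex in Ky nzy regy.
exists x; split=> // [a|]; first by rewrite /contraction /= rmorphM; apply: nzy.
suff -> : adjoin (contraction L) x = contraction (adjoin L (to_loc x)) by exact: IH.
apply/seteqP; split=> a [c Lc].
  by exists (to_loc c); rewrite -rmorphM -rmorphB.
have [d ed] := surj c.
by exists d; rewrite /contraction /= rmorphB rmorphM /= -ed.
Qed.

Lemma contraction_set0 : (forall s, ~ P s -> exists u, u * s = 1) ->
  contraction [set 0] = [set 0].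
Proof.
move=> unitA; apply/seteqP; split=> [a /to_loc_eq0[u /unitA[v vu] ua]|_ ->].
  by rewrite /= -[a]mul1r -vu -mulrA ua mulr0.
exact: rmorph0.
Qed.

End Localization.

(** * Suprema of sets of natural numbers in the extended integers *)

Section ExtendedIntegers.
Implicit Types (T U : set nat) (l n t : nat).

Lemma esup_le (S : set (\bar int)) y : (esup S <= y)%E <-> ubound S y.
Proof.
have [ubS leS] := esupP S; split=> [Sy x Sx|]; last exact: leS.
exact: le_trans (ubS _ Sx) Sy.
Qed.

(** Dimension, height and depth all have this form. Bounds on them become statements about single
    lengths, in which infinite values no longer appear. *)
Definition nat_sup T : \bar int := esup [set n%:Z%:E | n in T].

Lemma nat_sup_le T y : (nat_sup T <= y)%E <-> forall t, T t -> (t%:Z%:E <= y)%E.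
Proof.
rewrite /nat_sup esup_le; split=> [ubT t Tt|ubT _ [t Tt <-]]; last exact: ubT.
by apply: ubT; exists t.
Qed.

Lemma le_nat_sup T t : T t -> (t%:Z%:E <= nat_sup T)%E.
Proof. by move: t; apply/nat_sup_le. Qed.

(** By integrality, if every [u] in [U] is below [t - l], then [t - l - 1] bounds [U] and its
    supremum. *)
Lemma le_nat_supD U t l :
  (t%:Z%:E <= nat_sup U + l%:Z%:E)%E <-> exists2 u, U u & (t <= u + l)%N.
Proof.
split=> [tU|[u Uu tul]]; last first.
  apply: le_trans (leeD2r _ (le_nat_sup Uu)).
  by rewrite -EFinD lee_fin -PoszD lez_nat.
apply: contrapT => noU.
have : (nat_sup U <= (t%:Z - l%:Z - 1)%:E)%E.
  apply/nat_sup_le => u Uu; have [tul|] := leqP t (u + l).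
    by case: noU; exists u.
  by rewrite lee_fin; lia.
move=> /(leeD2r l%:Z%:E)/(le_trans tU); rewrite -EFinD lee_fin; lia.
Qed.

(** Nonemptiness keeps the supremum of [U] away from [-oo]. If it is [+oo], the difference is [-oo]
    and the bound holds, as does the one obtained by moving the supremum to the right. *)
Lemma nat_supB_le T U l : U !=set0 ->
  (nat_sup T - nat_sup U <= l%:Z%:E)%E <->
  forall t, T t -> exists2 u, U u & (t <= u + l)%N.
Proof.
move=> [u0 Uu0].
have -> : (nat_sup T - nat_sup U <= l%:Z%:E)%E <->
          (nat_sup T <= nat_sup U + l%:Z%:E)%E.
  have := le_nat_sup Uu0; case: (nat_sup U) => [u _| _ |//].
    by rewrite leeBlDr// addeC.
  by rewrite addye// leey addeNy leNye.
rewrite nat_sup_le; split=> h t /h; by rewrite le_nat_supD.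
Qed.

(** Here the quantifier over [n] disappears: [n = t] makes the minimum equal to [t], and conversely
    the minimum never exceeds the supremum of [T]. *)
Lemma nat_sup_min_le T U l :
  (forall n, (Order.min (nat_sup T) n%:Z%:E - l%:Z%:E <= nat_sup U)%E) <->
  forall t, T t -> exists2 u, U u & (t <= u + l)%N.
Proof.
split=> [h t Tt|h n].
  apply/le_nat_supD; have := h t.
  by rewrite leeBlDr// (min_idPr (le_nat_sup Tt)).
rewrite leeBlDr// ge_min; apply/orP; left; apply/nat_sup_le => t /h.
by rewrite le_nat_supD.
Qed.

End ExtendedIntegers.

(** * Dimension, height and depth as sets of lengths *)

Section Invariants.
Variable A : comPzRingType.

Definition chain_lengths : set nat := [set n | exists c : nat -> Spec A, prime_chain n c].

Definition height_lengths (p : Spec A) : set nat :=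
  [set n | exists2 c, prime_chain n c & c n = p].

Definition depth_lengths : set nat := [set n | exists t : seq A,
  [/\ size t = n, regular_seq t & forall x, x \in t -> max_ideal A x]].

Lemma depthE : depth A = nat_sup depth_lengths.
Proof.
rewrite /depth /nat_sup; congr esup; apply/seteqP; split=> x /=.
  by case=> t [rt mt] <-; exists (size t); [exists t|].
by case=> n [t [<- rt mt]] <-; exists t.
Qed.

Lemma local_cmd_le l : depth_lengths !=set0 ->
  (local_cmd A <= l%:Z%:E)%E <->
  forall n, chain_lengths n -> exists2 d, depth_lengths d & (n <= d + l)%N.
Proof. by rewrite /local_cmd depthE; apply: nat_supB_le. Qed.

End Invariants.

Lemma localization_depth_lengths_nonempty (A : comPzRingType) (p : Spec A) :
  depth_lengths (localization p) !=set0.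
Proof. by exists 0%N; apply/localization_depth. Qed.

Lemma property_C_lengths (A : comPzRingType) l :
  (forall n, property_C n l A) <->
  forall p : Spec A, forall h, height_lengths p h ->
    exists2 d, depth_lengths (localization p) d & (h <= d + l)%N.
Proof.
split=> [C p|C n p]; last by rewrite depthE; move: n; apply/nat_sup_min_le/C.
by apply/nat_sup_min_le => n; rewrite -depthE; apply: C.
Qed.

(** The condition on the right is the one of [property_C_lengths], which settles the non-local case
    prime by prime. *)
Lemma local_cmd_localization_le (A : comPzRingType) (p : Spec A) l :
  (local_cmd (localization p) <= l%:Z%:E)%E <->
  forall h, height_lengths p h ->
    exists2 d, depth_lengths (localization p) d & (h <= d + l)%N.
Proof.
rewrite local_cmd_le; last exact: localization_depth_lengths_nonempty.
by split=> h n /localization_dim/h.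
Qed.

(** * Local rings and the equivalence *)

Lemma local_max_ideal (A : comPzRingType) : is_local A ->
  maximal_ideal (max_ideal A) /\ forall M, maximal_ideal M -> M = max_ideal A.
Proof.
move=> [M [maxM uniqM]].
have maxA : maximal_ideal (max_ideal A) by apply: (@getPex _ (@maximal_ideal A)); exists M.
by split=> // N /uniqM <-; exact: uniqM.
Qed.

Lemma local_unit (A : comPzRingType) : noetherian A -> is_local A ->
  forall s, ~ max_ideal A s -> exists u, u * s = 1.
Proof.
move=> noeA /local_max_ideal[_ uniqM] s ms.
have [[c]|s1] := pselect (adjoin [set 0] s 1).
  by move=> /eqP; rewrite subr_eq0 => /eqP e; exists c.
have [|M /uniqM -> sM] := maximal_above noeA (adjoin_ideal s (@ideal_set0 A)).
  by move=> eT; apply: s1; rewrite eT.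
by case: ms; apply: sM; apply: mem_adjoin; exact: ideal_set0.
Qed.

(* A chain of length [h] below [p], a maximal regular sequence of length [n]
   and the splitting [n = g + (n - g)] give [h + n - g <= dim A <= n + l]
   and [g <= depth A_p]. *)
Lemma local_cmd_localization_lengths (A : comPzRingType) (p : Spec A) l :
  noetherian A -> is_local A -> (local_cmd A <= l%:Z%:E)%E ->
  forall h, height_lengths p h ->
    exists2 d, depth_lengths (localization p) d & (h <= d + l)%N.
Proof.
move=> noeA locA cmdA h [c cP ch].
have [maxm uniqm] := local_max_ideal locA; set m := max_ideal A in maxm uniqm.
have [idm m1 _] := maximal_prime maxm.
have depthP n : depth_lengths A n <-> has_regular m n [set 0] by exact: regular_seqE.
have {}cmdA : forall n, chain_lengths A n ->
    exists2 d, depth_lengths A d & (n <= d + l)%N.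
  by apply/local_cmd_le => //; exists 0%N; apply/depthP.
have radm x : m x -> exists u, u * (1 - x) = 1.
  move=> mx; apply: local_unit => // m1x; apply: m1.
  by rewrite -(subrK x 1); apply: idealD.
have primep := svalP p; have [idp p1 _] := primep.
have pm : sval p `<=` m.
  have [|M /uniqm -> //] := maximal_above noeA idp.
  by move=> eT; apply: p1; rewrite eT.
have [N depN maxN] : exists2 N, has_regular m N [set 0] &
    forall n, has_regular m n [set 0] -> (n <= N)%N.
  have [|K noK] := has_regular_bounded noeA idm m1 (@ideal_set0 A).
    by move=> _ ->; apply: ideal0.
  pose dep n := `[< has_regular m n [set 0] >].
  have ex : exists n, dep n by exists 0%N; apply/asboolP.
  (* [noK] excludes only the length [K]; a longer sequence would have a prefix of that length. *)
  have ub n : dep n -> (n <= K)%N.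
    move=> /asboolP regn; rewrite leqNgt; apply/negP => /ltnW Kn.
    by apply: noK; apply: has_regular_leq regn.
  have [N /asboolP depN maxN] := ex_maxnP ex ub.
  by exists N => // n regn; apply: maxN; apply/asboolP.
have [g [gN regg chg]] := regular_split noeA (@ideal_set0 A) radm idm primep pm depN.
have [d /depthP/maxN dN hd] := cmdA _ (prime_chain_extend cP ch chg).
exists g; last lia.
apply/localization_depth; rewrite -extension_set0.
by apply: has_regular_extension => //; exact: ideal_set0.
Qed.

Theorem theorem3p8 (A : comPzRingType) (l : nat) :
  noetherian A ->
  ((cmd A <= l%:Z%:E)%E <-> forall n : nat, property_C n l A).
Proof.
move=> noeA; rewrite property_C_lengths /cmd; case: asboolP => locA; last first.
  rewrite esup_le; split=> [ub p|C _ [p _ <-]]; last exact/local_cmd_localization_le/C.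
  by apply/local_cmd_localization_le/ub; exists p.
split=> [cmdA p|C]; first exact: local_cmd_localization_lengths.
(* For the converse, [C] is applied at the maximal ideal: every chain can be made to end there, and
   regular sequences of the localization come back to [A]. *)
have [maxm uniqm] := local_max_ideal locA.
have primem := maximal_prime maxm; have [idm m1 _] := primem.
pose m : Spec A := exist _ _ primem.
have unitA := local_unit noeA locA.
have depthP n : depth_lengths A n <-> has_regular (max_ideal A) n [set 0].
  exact: regular_seqE.
apply/local_cmd_le; first by exists 0%N; apply/depthP.
move=> n [c cP]; have [|d depd nd] := C m n.
  apply: (prime_chain_top cP); have [idc c1 _] := svalP (c n).
  have [|M /uniqm -> //] := maximal_above noeA idc.
  by move=> eT; apply: c1; rewrite eT.
exists d => //; apply/depthP.
have [idE _ _] := extension_prime (p := m) primem (@subset_refl _ _).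
move/localization_depth: depd => /(has_regular_contraction (p := m) unitA idE).
rewrite (contraction_set0 (p := m) unitA).
by rewrite (contraction_extension (p := m) primem)//; exact: subset_refl.
Qed.
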